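(* Let $p\colon E\to B$ be a fibration. If $\xi_1,\dots,\xi_l\in H^*(B)$ are positive dimensional cohomology classes whose product is non-zero, then $$g(p)>\sum_{i=1}^{l}\mathrm{wgt}_p(\xi_i).$$
   Context: Cohomology is taken with $\mathbb{Z}_2$ coefficients. The Schwarz genus $g(p)$ of a continuous map $p\colon E\to B$ is the minimum cardinality of a covering of $B$ by open sets over each of which $p$ has a continuous section; by convention $g(p)=0$ iff $E=\emptyset=B$. For a continuous map $f\colon X\to B$, $f^*p\colon f^*(E)\to X$ denotes the pull-back fibration. For $\xi\in H^*(B)$, the sectional category weight $\mathrm{wgt}_p(\xi)$ of $\xi$ with respect to the fibration $p$ is the largest integer $k$ such that for any continuous map $f\colon X\to B$ with $g(f^*p)\leq k$ we have $f^*(\xi)=0$; one sets $\mathrm{wgt}_p(\xi)=\infty$ when $\xi=0$.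
   Formalization: The theorem assumes that the genus g(p) or the sum of the weights is finite; this excludes only the comparison of infinity with infinity, which occurs e.g. for E empty, B a circle and the generator of its first cohomology, where no largest integer k exists. *)

(* Defs.v *)
From HB Require Import structures.
From mathcomp Require Import all_boot all_order all_algebra.
From mathcomp Require Import all_classical all_reals all_analysis.
From mathcomp Require Import ring_quotient zify.

Set Implicit Arguments.
Unset Strict Implicit.
Unset Printing Implicit Defensive.

Import Order.TTheory GRing.Theory Num.Theory.
Import numFieldNormedType.Exports.
Import Quotient.Exports.

Local Open Scope classical_set_scope.
Local Open Scope ring_scope.
Local Open Scope quotient_scope.

(** * Singular cohomology with coefficients in the field with two elements *)

Definition stdsimplex (R : realType) (n : nat) : set 'rV[R]_n.+1 :=
  [set t | (forall i, 0 <= t ord0 i) /\ \sum_i t ord0 i = 1].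
Arguments stdsimplex : clear implicits.

Section SimplexMap.
Variables (R : realType) (m n : nat) (a : 'I_m.+1 -> 'I_n.+1).

(* The affine extension of a map [a] between the sets of vertices. *)
Definition affine_ext (t : 'rV[R]_m.+1) : 'rV[R]_n.+1 :=
  \row_j \sum_(i | a i == j) t ord0 i.

Lemma affine_ext_simplex (t : stdsimplex R m) :
  affine_ext (set_val t) \in stdsimplex R n.
Proof.
have [t0 t1] : stdsimplex R m (set_val t) by exact: set_valP.
apply/mem_set; split=> [j|].
  by rewrite mxE; apply: sumr_ge0 => i _; exact: t0.
rewrite -[RHS]t1 (partition_big a xpredT) //=.
by apply: eq_bigr => j _; rewrite mxE.
Qed.

Definition simplex_fun (t : stdsimplex R m) : stdsimplex R n :=
  exist _ (affine_ext (set_val t)) (affine_ext_simplex t).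

Lemma coord_sum_continuous (r : seq 'I_m.+1) (P : pred 'I_m.+1) :
  continuous (fun t : 'rV[R]_m.+1 => \sum_(i <- r | P i) t ord0 i).
Proof.
elim: r => [|k r IHr].
  have -> : (fun t : 'rV[R]_m.+1 => \sum_(i <- [::] | P i) t ord0 i) = cst 0.
    by apply/funext => u; rewrite big_nil.
  exact: cst_continuous.
have -> : (fun t : 'rV[R]_m.+1 => \sum_(i <- k :: r | P i) t ord0 i) =
    (fun t => (if P k then t ord0 k else 0) + \sum_(i <- r | P i) t ord0 i).
  by apply/funext => u; rewrite big_cons; case: ifP; rewrite ?add0r.
move=> t; apply: (@continuousD R R); last exact: IHr.
by case: (P k); [exact: coord_continuous | exact: cst_continuous].
Qed.

Lemma affine_ext_continuous : continuous affine_ext.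
Proof.
move=> t P [Q nQ sQ].
have cv i j : (fun s => affine_ext s i j) @ t --> affine_ext t i j.
  have -> : (fun s => affine_ext s i j) = (fun s => \sum_(k | a k == j) s ord0 k).
    by apply/funext => s; rewrite mxE.
  by rewrite mxE; exact: coord_sum_continuous.
have F : Filter (nbhs t) := @nbhs_filter 'rV[R]_m.+1 t.
have : \forall s \near t, forall ij : 'I_1 * 'I_n.+1,
    Q ij.1 ij.2 (affine_ext s ij.1 ij.2).
  apply: (@filter_forall _ _
    (fun (ij : 'I_1 * 'I_n.+1) s => Q ij.1 ij.2 (affine_ext s ij.1 ij.2)) _ F).
  by move=> [i j] /=; apply: cv; exact: nQ.
by apply: filterS => s sP; apply: sQ => i j; exact: (sP (i, j)).
Qed.

Lemma simplex_fun_continuous : continuous simplex_fun.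
Proof.
apply/continuousP => U [V oV <-].
have -> : simplex_fun @^-1` (set_val @^-1` V) =
    set_val @^-1` (affine_ext @^-1` V) by [].
exists (affine_ext @^-1` V) => //.
by move/continuousP: affine_ext_continuous; exact.
Qed.

Definition simplex_map : continuousType (stdsimplex R m) (stdsimplex R n) :=
  mkcts simplex_fun_continuous.

End SimplexMap.

Lemma simplex_map_comp (R : realType) (m n k : nat) (a : 'I_n.+1 -> 'I_k.+1)
    (b : 'I_m.+1 -> 'I_n.+1) (t : stdsimplex R m) :
  simplex_map R a (simplex_map R b t) = simplex_map R (a \o b) t.
Proof.
apply: val_inj => /=; apply/rowP => j; rewrite !mxE.
under eq_bigr do rewrite mxE.
rewrite (exchange_big_dep (fun i => a (b i) == j)) /=; last first.
  by move=> i u /eqP <- /eqP ->.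
apply: eq_bigr => u /eqP auj; rewrite (big_pred1 (b u)) // => i /=.
by rewrite eq_sym andbC; case: eqVneq => //= <-; exact/eqP.
Qed.

Lemma F2_addrr (x : 'F_2) : x + x = 0.
Proof. by apply: addrr_pchar2; exact: pchar_Fp. Qed.

Section SingularCochains.
Variable R : realType.
Implicit Types X Y : topologicalType.

Definition singular (n : nat) X := continuousType (stdsimplex R n) X.

Definition reindex {m n : nat} {X} (s : singular n X)
    (a : 'I_m.+1 -> 'I_n.+1) : singular m X :=
  [the continuousType _ _ of s \o simplex_map R a].

Lemma reindex_comp (m n k : nat) X (s : singular k X) (a : 'I_n.+1 -> 'I_k.+1)
    (b : 'I_m.+1 -> 'I_n.+1) :
  reindex (reindex s a) b = reindex s (a \o b).
Proof. by apply/continuousEP => t /=; rewrite simplex_map_comp. Qed.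

Lemma eq_reindex (m n : nat) X (s : singular n X) (a b : 'I_m.+1 -> 'I_n.+1) :
  a =1 b -> reindex s a = reindex s b.
Proof. by move=> /funext ->. Qed.

Definition push {n : nat} {X Y} (f : continuousType X Y) (s : singular n X) :
    singular n Y :=
  [the continuousType _ _ of f \o s].

Lemma push_reindex (m n : nat) X Y (f : continuousType X Y) (s : singular n X)
    (a : 'I_m.+1 -> 'I_n.+1) :
  push f (reindex s a) = reindex (push f s) a.
Proof. exact/continuousEP. Qed.

Definition cochain (n : nat) X := singular n X -> 'F_2.
HB.instance Definition _ n X :=
  GRing.Zmodule.copy (cochain n X) (singular n X -> 'F_2).

(* No alternating signs: the coefficients have characteristic two. *)
Definition delta {n : nat} {X} (c : cochain n X) : cochain n.+1 X :=
  fun s => \sum_(i < n.+2) c (reindex s (lift i)).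

Lemma deltaB (n : nat) X (b c : cochain n X) :
  delta (b - c) = delta b - delta c.
Proof. by apply/funext => s; exact: sumrB. Qed.

Lemma delta0 (n : nat) X : delta (0 : cochain n X) = 0.
Proof. by apply/funext => s; exact: big1. Qed.

Definition cochain_pull {n : nat} {X Y} (f : continuousType X Y)
    (c : cochain n Y) : cochain n X := c \o push f.

Lemma delta_pull (n : nat) X Y (f : continuousType X Y) (c : cochain n Y) :
  delta (cochain_pull f c) = cochain_pull f (delta c).
Proof.
by apply/funext => s; apply: eq_bigr => i _; rewrite /cochain_pull /= push_reindex.
Qed.

(* The product of [a] on the front [m]-face with [b] on the back [n]-face.  It
   is meant for [k = m + n]; leaving [k] free avoids transporting cochains along
   equations between degrees. *)
Definition cochain_cup {m n : nat} (k : nat) {X} (a : cochain m X)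
    (b : cochain n X) : cochain k X :=
  fun s => a (reindex s (fun i => inord i)) * b (reindex s (fun i => inord (m + i))).
Arguments cochain_cup {m n} k {X} a b.

Lemma cochain_cup0l (m n k : nat) X (b : cochain n X) :
  cochain_cup k (0 : cochain m X) b = 0.
Proof. by apply/funext => s; exact: mul0r. Qed.

Lemma cochain_cup0r (m n k : nat) X (a : cochain m X) :
  cochain_cup k a (0 : cochain n X) = 0.
Proof. by apply/funext => s; exact: mulr0. Qed.

Lemma delta_cup (m n : nat) X (a : cochain m X) (b : cochain n X) :
  delta (cochain_cup (m + n)%N a b) =
  cochain_cup (m + n).+1 (delta a) b + cochain_cup (m + n).+1 a (delta b).
Proof.
apply/funext => s; rewrite /delta.
pose A (f : nat -> nat) := a (reindex s (fun i : 'I_m.+1 => inord (f i))).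
pose B (f : nat -> nat) := b (reindex s (fun i : 'I_n.+1 => inord (f i))).
have eA f g : (forall x, (x <= m)%N -> f x = g x) -> A f = A g.
  by move=> fg; congr a; apply: eq_reindex => x; rewrite fg // -ltnS.
have eB f g : (forall x, (x <= n)%N -> f x = g x) -> B f = B g.
  by move=> fg; congr b; apply: eq_reindex => x; rewrite fg // -ltnS.
transitivity (\sum_(0 <= i < (m + n).+2)
    A (fun x => bump i x) * B (fun x => bump i (m + x))).
  rewrite big_mkord; apply: eq_bigr => i _; rewrite /cochain_cup !reindex_comp.
  by congr (_ * _); [congr a | congr b]; apply: eq_reindex => x;
    apply: val_inj; rewrite /= !inordK /bump //;
    move: (ltn_ord x) (ltn_ord i); lia.
have -> : (cochain_cup (m + n).+1 (delta a) b + cochain_cup (m + n).+1 a (delta b)) s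
   = \sum_(0 <= i < m.+2) A (fun x => bump i x) * B (fun x => m.+1 + x)%N
   + \sum_(0 <= j < n.+2) A id * B (fun x => m + bump j x)%N.
  rewrite !big_mkord [LHS]/= /cochain_cup /delta /=.
  congr (_ + _).
    rewrite mulr_suml; apply: eq_bigr => i _; rewrite reindex_comp.
    rewrite /A; congr (a _ * _); exact: eq_reindex.
  rewrite mulr_sumr; apply: eq_bigr => i _; rewrite reindex_comp.
  rewrite /B; congr (_ * b _); exact: eq_reindex.
rewrite (@big_cat_nat _ _ _ m.+1) //=; last by lia.
rewrite [X in _ = X + _]big_nat_recr //= [X in _ = _ + X]big_nat_recl //=.
rewrite (eA (bump m.+1) id); last by move=> x xm; rewrite /bump; case: leqP; lia.
rewrite (eB (fun x => m + bump 0 x)%N (fun x => m.+1 + x)%N); last first.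
  by move=> x _; rewrite /bump; lia.
rewrite -!addrA [A id * _ + (_ + _)]addrA F2_addrr add0r; congr (_ + _).
  apply: eq_big_nat => i /andP[_ im]; congr (_ * _).
  by apply: eB => x _; rewrite /bump; lia.
rewrite -{1}[m.+1]add0n big_addn (_ : (m + n).+2 - m.+1 = n.+1)%N; last by lia.
apply: eq_big_nat => i _; congr (_ * _).
  by apply: eA => x xm; rewrite /bump; lia.
by apply: eB => x _; rewrite /bump; lia.
Qed.

Definition cocycles (n : nat) X : {pred cochain n X} :=
  fun c => delta c == 0.

Lemma cocycles_closed (n : nat) X : zmod_closed (@cocycles n X).
Proof.
split=> [|b c /eqP b0 /eqP c0]; apply/eqP.
  exact: delta0.
by rewrite deltaB b0 c0 subrr.
Qed.
HB.instance Definition _ n X :=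
  GRing.isZmodClosed.Build (cochain n X) (@cocycles n X) (cocycles_closed n X).

Definition coboundary {n : nat} {X} : cochain n X -> Prop :=
  match n with
  | 0 => fun c => c = 0
  | k.+1 => fun c => exists b : cochain k X, delta b = c
  end.

Lemma coboundary0 (n : nat) X : coboundary (0 : cochain n X).
Proof. by case: n => //= n; exists 0; exact: delta0. Qed.

Record cocycle (n : nat) X :=
  Cocycle { cocycle_val :> cochain n X; _ : cocycle_val \in @cocycles n X }.
HB.instance Definition _ n X := [isSub for @cocycle_val n X].
HB.instance Definition _ n X := [Choice of cocycle n X by <:].
HB.instance Definition _ n X := [SubChoice_isSubZmodule of cocycle n X by <:].

Definition coboundaries (n : nat) X : {pred cocycle n X} :=
  fun z => `[< coboundary (val z) >].

Lemma coboundaries_closed (n : nat) X : zmod_closed (@coboundaries n X).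
Proof.
split; first by apply/asboolP; exact: coboundary0.
move=> y z /asboolP cy /asboolP cz; apply/asboolP; move: cy cz; rewrite raddfB.
case: n y z => [|n] y z /=; first by move=> -> ->; rewrite subrr.
by move=> [b <-] [c <-]; exists (b - c); rewrite deltaB.
Qed.
HB.instance Definition _ n X :=
  GRing.isZmodClosed.Build (cocycle n X) (@coboundaries n X)
    (coboundaries_closed n X).

Definition cohomology (n : nat) X := Quotient.quot (@coboundaries n X).
HB.instance Definition _ n X := GRing.Zmodule.on (cohomology n X).

Definition cohomology_class {n : nat} {X} (z : cocycle n X) : cohomology n X :=
  \pi_(Quotient.quot (@coboundaries n X)) z.

Lemma cohomology_classP (n : nat) X (y z : cocycle n X) :
  cohomology_class y = cohomology_class z <->
  coboundary (cocycle_val y - cocycle_val z).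
Proof.
rewrite -(raddfB (val : cocycle n X -> cochain n X)).
split=> [/eqP|yz]; last apply/eqP; rewrite -Quotient.idealrBE.
  by move/asboolP.
exact/asboolP.
Qed.

Lemma cohomology_reprK (n : nat) X (xi : cohomology n X) :
  cohomology_class (repr xi) = xi.
Proof. exact: reprK. Qed.

Lemma cohomology_repr (n : nat) X (z : cocycle n X) :
  coboundary (cocycle_val (repr (cohomology_class z)) - cocycle_val z).
Proof. by apply/cohomology_classP; exact: cohomology_reprK. Qed.

Lemma cocycleP (n : nat) X (z : cocycle n X) : delta (cocycle_val z) = 0.
Proof. by case: z => z /= /eqP. Qed.

Lemma coboundaryD (n : nat) X (a b : cochain n X) :
  coboundary a -> coboundary b -> coboundary (a + b).
Proof.
case: n a b => [|n] a b /=; first by move=> -> ->; rewrite addr0.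
move=> [c <-] [d <-]; exists (c - - d); rewrite deltaB -[- d]add0r deltaB.
by rewrite delta0 sub0r opprK.
Qed.

(** ** Induced maps *)

Lemma cocycle_pull_subproof (n : nat) X Y (f : continuousType X Y)
    (z : cocycle n Y) : cochain_pull f z \in @cocycles n X.
Proof. by apply/eqP; rewrite delta_pull cocycleP. Qed.

Definition cocycle_pull {n : nat} {X Y} (f : continuousType X Y)
    (z : cocycle n Y) : cocycle n X :=
  Cocycle (cocycle_pull_subproof f z).

Definition cohomology_pull {n : nat} {X Y} (f : continuousType X Y)
    (xi : cohomology n Y) : cohomology n X :=
  cohomology_class (cocycle_pull f (repr xi)).

Lemma coboundary_pull (n : nat) X Y (f : continuousType X Y) (c : cochain n Y) :
  coboundary c -> coboundary (cochain_pull f c).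
Proof.
case: n c => [|n] c /=; first by move=> ->.
by move=> [b <-]; exists (cochain_pull f b); rewrite delta_pull.
Qed.

Lemma cohomology_pull_class (n : nat) X Y (f : continuousType X Y)
    (z : cocycle n Y) :
  cohomology_pull f (cohomology_class z) = cohomology_class (cocycle_pull f z).
Proof.
apply/cohomology_classP.
exact: (coboundary_pull f (cohomology_repr z)).
Qed.

(** ** Cup product *)

Lemma cocycle_cup_subproof (m n : nat) X (y : cocycle m X) (z : cocycle n X) :
  cochain_cup (m + n)%N y z \in @cocycles (m + n) X.
Proof.
by apply/eqP; rewrite delta_cup !cocycleP cochain_cup0l cochain_cup0r addr0.
Qed.

Definition cocycle_cup {m n : nat} {X} (y : cocycle m X) (z : cocycle n X) :
    cocycle (m + n) X :=
  Cocycle (cocycle_cup_subproof y z).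

Definition cup {m n : nat} {X} (xi : cohomology m X) (eta : cohomology n X) :
    cohomology (m + n) X :=
  cohomology_class (cocycle_cup (repr xi) (repr eta)).

Lemma coboundary_cupl (m n k : nat) X (a : cochain m X) (b : cochain n X) :
  k = (m + n)%N -> coboundary a -> delta b = 0 -> coboundary (cochain_cup k a b).
Proof.
move=> -> {k}; case: m a => [|m] a /=.
  by move=> -> _; rewrite cochain_cup0l; exact: coboundary0.
move=> [c <-] b0; exists (cochain_cup (m + n)%N c b).
by rewrite delta_cup b0 cochain_cup0r addr0.
Qed.

Lemma coboundary_cupr (m n k : nat) X (a : cochain m X) (b : cochain n X) :
  k = (m + n)%N -> delta a = 0 -> coboundary b -> coboundary (cochain_cup k a b).
Proof.
move=> -> {k}; case: n b => [|n] b /=.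
  by move=> _ ->; rewrite cochain_cup0r; exact: coboundary0.
move=> a0 [c <-]; rewrite addnS; exists (cochain_cup (m + n)%N a c).
by rewrite delta_cup a0 cochain_cup0l add0r.
Qed.

Lemma cup_class (m n : nat) X (y : cocycle m X) (z : cocycle n X) :
  cup (cohomology_class y) (cohomology_class z) =
  cohomology_class (cocycle_cup y z).
Proof.
apply/cohomology_classP.
set y' := repr _; set z' := repr _.
have -> : cocycle_val (cocycle_cup y' z') - cocycle_val (cocycle_cup y z) =
    cochain_cup (m + n)%N (cocycle_val y' - cocycle_val y) z' +
    cochain_cup (m + n)%N y (cocycle_val z' - cocycle_val z).
  have E (a a' b b' : 'F_2) : a' * b' - a * b = (a' - a) * b' + a * (b' - b).
    by rewrite mulrBl mulrBr addrA subrK.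
  by apply/funext => s; exact: E.
apply: coboundaryD.
  by apply: coboundary_cupl => //; [exact: cohomology_repr | exact: cocycleP].
by apply: coboundary_cupr => //; [exact: cocycleP | exact: cohomology_repr].
Qed.

Lemma cocycle_one_subproof X : (fun=> 1 : 'F_2) \in @cocycles 0 X.
Proof.
by apply/eqP/funext => s; rewrite /delta 2!big_ord_recl big_ord0 addr0 F2_addrr.
Qed.

Definition cohomology_one X : cohomology 0 X :=
  cohomology_class (Cocycle (cocycle_one_subproof X)).

(* A cohomology class together with its degree, so that finitely many classes
   of various degrees can be multiplied. *)
Definition homogeneous X := {n : nat & cohomology n X}.

Definition homogeneous_cup {X} (u v : homogeneous X) : homogeneous X :=
  existT (cohomology^~ X) _ (cup (tagged u) (tagged v)).

Definition homogeneous_one X : homogeneous X := existT (cohomology^~ X) _ (cohomology_one X).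

Definition cup_prod {X} {l : nat} {d : 'I_l -> nat}
    (xi : forall i, cohomology (d i) X) : homogeneous X :=
  \big[homogeneous_cup/homogeneous_one X]_(i < l)
    (existT (cohomology^~ X) (d i) (xi i)).

End SingularCochains.

(** * Fibrations and their Schwarz genus *)

Definition unit_interval (R : realType) : set R := `[0, 1].
Arguments unit_interval : clear implicits.

(* Hurewicz fibrations: the homotopy lifting property for all spaces. *)
Definition fibration (R : realType) (E B : topologicalType)
    (p : continuousType E B) : Prop :=
  forall (X : topologicalType) (H : continuousType (X * unit_interval R)%type B)
    (h : continuousType X E),
    (forall x t, set_val t = 0 -> H (x, t) = p (h x)) ->
    exists K : continuousType (X * unit_interval R)%type E,
      (forall x t, set_val t = 0 -> K (x, t) = h x) /\
      (forall z, p (K z) = H z).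

Definition has_section_over (E B : topologicalType) (p : continuousType E B)
    (U : set B) : Prop :=
  exists s : continuousType U E, forall x : U, p (s x) = set_val x.

Definition sectional_cover (E B : topologicalType) (p : continuousType E B)
    (k : nat) (U : 'I_k -> set B) : Prop :=
  (forall i, open (U i) /\ has_section_over p (U i)) /\ \bigcup_i U i = setT.

(* It is [+oo] when there is no finite cover of this kind. *)
Definition genus (R : realType) (E B : topologicalType)
    (p : continuousType E B) : \bar R :=
  ereal_inf [set k%:R%:E | k in [set k : nat |
    exists U : 'I_k -> set B, sectional_cover p U]].

Definition pullback_space (E B X : topologicalType) (p : continuousType E B)
    (f : continuousType X B) : set (X * E)%type :=
  [set z | f z.1 = p z.2].

Lemma pullback_map_continuous (E B X : topologicalType)
    (p : continuousType E B) (f : continuousType X B) :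
  continuous (fun z : pullback_space p f => (set_val z).1).
Proof.
apply/continuousP => U oU; exists (fst @^-1` U) => //.
by apply: open_comp => // z _; exact: cvg_fst.
Qed.

Definition pullback_map (E B X : topologicalType) (p : continuousType E B)
    (f : continuousType X B) : continuousType (pullback_space p f) X :=
  mkcts (@pullback_map_continuous E B X p f).

(** * Sectional category weight *)

(* The set of admissible [k] contains [0] and is closed downwards: its supremum
   is its largest element when it is bounded, and [+oo] otherwise, in particular
   when [xi = 0]. *)
Definition wgt (R : realType) (E B : topologicalType) (p : continuousType E B)
    (n : nat) (xi : cohomology R n B) : \bar R :=
  ereal_sup [set k%:R%:E | k in [set k : nat |
    forall (X : topologicalType) (f : continuousType X B),
      (genus R (pullback_map p f) <= k%:R%:E)%E -> cohomology_pull f xi = 0]].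

(* Main.v *)
Require Import Defs.
From mathcomp Require Import all_boot all_order all_algebra.
From mathcomp Require Import all_classical all_reals all_analysis.

(** If [B] is covered by open sets [A i] such that each [xi i] restricts to zero
    on [A i], then the product of the [xi i] is zero.  The inequality follows
    from this vanishing lemma of Lusternik and Schnirelmann ([cup_prod_eq0]).
    Suppose that the genus is [k], attained by a cover with sections, and that
    [k] is at most the sum of the weights.  By definition of the weight there
    are admissible integers [m i] with [k <= \sum_i m i], so the [k] open sets
    can be distributed into [l] groups, the [i]-th having at most [m i] members
    ([distribute]).  Let [A i] be the union of the [i]-th group.  The sections
    pull back along the inclusion of [A i], whose pull-back fibration therefore
    has genus at most [m i] ([genus_pullback]); as [m i] is admissible, [xi i]
    restricts to zero on [A i].  The [A i] cover [B], hence the product of the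
    classes is zero.

    For the vanishing lemma, a class which is zero on [A i] is represented by a
    cocycle which vanishes on every singular simplex contained in [A i]
    ([relative_representative]).  On the level of cochains a cup product
    evaluates its factors on faces, so the product cocycle vanishes on all
    simplices contained in some [A i].  Such a cocycle is a coboundary
    ([small_cocycle_coboundary]); this is where the topology enters, through
    barycentric subdivision.

    Write [S] for the subdivision of cochains and [T] for the prism operator,
    with [T delta + delta T = 1 + S] over the field with two elements.  For a
    cocycle [c] and every [m] one gets [c + S^m c = delta (\sum_(j < m) S^j T c)].
    With [c], also [T c] vanishes on small simplices, because the prism of a
    simplex stays inside it.  By the Lebesgue number lemma [S^m c] and [S^m T c]
    vanish on a given simplex as soon as [m] is large, since then its [m]-th
    subdivision consists of small simplices.  The infinite sum [b = \sum_j S^j T c] is thus finite on each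
    simplex, and [delta b = c].

    The algebra of subdivision takes place on lists of vertices: the faces, the
    subdivision and the prism of a simplex are lists of lists, defined by coning
    from the barycenter.  The empty list is allowed as a simplex of dimension
    -1, which lets the recursions start without a special case in dimension
    zero.  An affine simplex is determined by its vertices, which carries the
    identities over to singular cochains. *)

Set Implicit Arguments.
Unset Strict Implicit.
Unset Printing Implicit Defensive.

Import Order.TTheory GRing.Theory Num.Theory.
Import numFieldNormedType.Exports.
Local Open Scope classical_set_scope.
Local Open Scope ring_scope.

(** * Barycentric subdivision of lists of vertices *)

Section ListSubdivision.
Variables (P : eqType) (bary : seq P -> P).
Implicit Types (v w f g : seq P) (phi : seq P -> 'F_2).

Fixpoint faces v : seq (seq P) :=
  if v is x :: s then s :: [seq x :: w | w <- faces s] else [::].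

(** The list [v] is meant to have length [n]: the recursion is on the
    length since most faces are not tails of [v]. *)
Fixpoint subdivision n v : seq (seq P) :=
  if n is m.+1 then [seq bary v :: w | f <- faces v, w <- subdivision m f]
  else [:: [::]].

(** The chain homotopy from the identity to the subdivision, again by coning:
    the boundary of the cone on [v + prism (boundary v)] is that chain itself plus
    the cone on its boundary. *)
Fixpoint prism n v : seq (seq P) :=
  if n is m.+1 then
    (bary v :: v) :: [seq bary v :: w | f <- faces v, w <- prism m f]
  else [::].

Lemma size_face v f : f \in faces v -> size f = (size v).-1.
Proof.
elim: v f => //= x s IHs f; rewrite inE => /predU1P[-> //|/mapP[g gs ->]] /=.
by rewrite (IHs _ gs); case: s gs {IHs}.
Qed.

Lemma mem_face v f : f \in faces v -> {subset f <= v}.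
Proof.
elim: v f => //= x s IHs f; rewrite inE => /predU1P[-> y ys|/mapP[g gs ->] y].
  by rewrite inE ys orbT.
by rewrite !inE => /predU1P[->|/(IHs _ gs) ->]; rewrite ?eqxx ?orbT.
Qed.

Lemma size_faces v : size (faces v) = size v.
Proof. by elim: v => //= x s <-; rewrite size_map. Qed.

Lemma nth_face x0 v i k : (i < size v)%N ->
  nth x0 (nth [::] (faces v) i) k = nth x0 v (bump i k).
Proof.
elim: v i k => //= x s IHs [|i] k //= ils.
rewrite (nth_map [::]) ?size_faces //.
by case: k => [|k] //=; rewrite IHs // /bump /= addnS.
Qed.

Lemma sum_faces_cons x v phi :
  \sum_(w <- faces (x :: v)) phi w = phi v + \sum_(w <- faces v) phi (x :: w).
Proof. by rewrite /= big_cons big_map. Qed.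

Lemma sum_faces_faces v phi :
  \sum_(f <- faces v) \sum_(g <- faces f) phi g = 0.
Proof.
elim: v phi => [|x s IHs] phi; first by rewrite big_nil.
rewrite sum_faces_cons; under [X in _ + X]eq_bigr do rewrite sum_faces_cons.
by rewrite big_split /= IHs addr0 F2_addrr.
Qed.

Lemma sum_subdivisionS n v phi :
  \sum_(w <- subdivision n.+1 v) phi w =
  \sum_(f <- faces v) \sum_(w <- subdivision n f) phi (bary v :: w).
Proof. by rewrite /= big_allpairs_dep. Qed.

Lemma sum_prismS n v phi :
  \sum_(w <- prism n.+1 v) phi w = phi (bary v :: v) +
  \sum_(f <- faces v) \sum_(w <- prism n f) phi (bary v :: w).
Proof. by rewrite /= big_cons big_allpairs_dep. Qed.

Lemma size_subdivision n v w :
  size v = n -> w \in subdivision n v -> size w = n.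
Proof.
elim: n v w => [|n IHn] v w sv /=; first by rewrite inE => /eqP ->.
case/allpairsPdep => f [g [fv gf ->]] /=; rewrite (IHn f) //.
by rewrite (size_face fv) sv.
Qed.

Lemma size_prism n v w : size v = n -> w \in prism n v -> size w = n.+1.
Proof.
elim: n v w => [|n IHn] v w sv //=.
rewrite inE => /predU1P[->|/allpairsPdep[f [g [fv gf ->]]]] /=; first by rewrite sv.
by rewrite (IHn f) // (size_face fv) sv.
Qed.

(** The boundary of the cone on a chain [z] is [z] plus the cone on the boundary
    of [z].  Here [z] is the subdivided boundary of [v], which is a cycle by
    induction on the dimension. *)
Lemma subdivision_boundary n v phi : size v = n.+1 ->
  \sum_(w <- subdivision n.+1 v) \sum_(f <- faces w) phi f =
  \sum_(f <- faces v) \sum_(w <- subdivision n f) phi w.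
Proof.
elim: n v phi => [|n IHn] v phi sv; rewrite sum_subdivisionS.
  by apply: eq_bigr => f _; rewrite /= !big_seq1 /= ?big_seq1.
under eq_bigr do (under eq_bigr do rewrite sum_faces_cons; rewrite big_split).
rewrite big_split /= [X in _ + X](_ : _ = 0) ?addr0 //.
rewrite [LHS](_ : _ = \sum_(f <- faces v) \sum_(g <- faces f)
   \sum_(w <- subdivision n g) phi (bary v :: w)); first exact: sum_faces_faces.
apply: eq_big_seq => f fv.
by rewrite (IHn f (fun w => phi (bary v :: w))) // (size_face fv) sv.
Qed.

(** Expanding the boundaries of the cones, the terms [prism n f] without apex
    cancel in pairs, and the induction hypothesis on the faces turns the
    remaining cones into the subdivision of [v], up to cones on the boundary of
    a boundary. *)
Lemma prism_boundary n v phi : size v = n ->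
  \sum_(w <- prism n v) \sum_(f <- faces w) phi f +
  \sum_(f <- faces v) \sum_(w <- prism n.-1 f) phi w =
  phi v + \sum_(w <- subdivision n v) phi w.
Proof.
elim: n v phi => [|n IHn] v phi sv.
  by rewrite (size0nil sv) /= !big_nil big_seq1 addr0 F2_addrr.
rewrite sum_prismS sum_subdivisionS sum_faces_cons /= -!addrA; congr (_ + _).
under [X in _ + (X + _)]eq_bigr do
  (under eq_bigr do rewrite sum_faces_cons; rewrite big_split).
rewrite big_split /= [X in _ + X]addrAC F2_addrr add0r -big_split /=.
transitivity (\sum_(f <- faces v) (\sum_(w <- subdivision n f) phi (bary v :: w) +
    \sum_(g <- faces f) \sum_(w <- prism n.-1 g) phi (bary v :: w))).
  apply: eq_big_seq => f fv.
  have sf : size f = n by rewrite (size_face fv) sv.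
  have := IHn f (fun w => phi (bary v :: w)) sf.
  move/(canRL (addrK _)) => ->; set a := phi _; set b := \sum_(w <- subdivision _ _) _.
  by rewrite !addrA F2_addrr add0r oppr_pchar2 //; exact: pchar_Fp.
rewrite big_split /= [X in _ + X](sum_faces_faces v) addr0 //.
Qed.

(** A convexity principle: sets closed under barycenters are not left. *)
Lemma subdivision_ind (D : P -> Prop) n v w : size v = n ->
  (forall u, u != [::] -> (forall x, x \in u -> D x) -> D (bary u)) ->
  (forall x, x \in v -> D x) -> w \in subdivision n v ->
  forall x, x \in w -> D x.
Proof.
move=> sv baryD; elim: n v w sv => [|n IHn] v w sv Dv /=.
  by rewrite inE => /eqP ->.
case/allpairsPdep => f [g [fv gf ->]] x; rewrite inE => /predU1P[->|xg].
  by apply: baryD => //; rewrite -size_eq0 sv.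
apply: (IHn f g) xg => //; first by rewrite (size_face fv) sv.
by move=> y /(mem_face fv) /Dv.
Qed.

End ListSubdivision.

Section SubdivisionMap.
Variables (P Q : eqType) (bP : seq P -> P) (bQ : seq Q -> Q) (h : P -> Q).
Hypothesis h_bary : forall v, v != [::] -> bQ (map h v) = h (bP v).

Lemma faces_map v : faces (map h v) = [seq map h f | f <- faces v].
Proof. by elim: v => //= x s ->; rewrite -!map_comp. Qed.

Lemma sum_subdivision_map n v (phi : seq Q -> 'F_2) : size v = n ->
  \sum_(w <- subdivision bQ n (map h v)) phi w =
  \sum_(w <- subdivision bP n v) phi (map h w).
Proof.
elim: n v phi => [|n IHn] v phi sv; first by rewrite /= !big_seq1.
rewrite !sum_subdivisionS faces_map big_map.
apply: eq_big_seq => f fv; rewrite (IHn f) ?(size_face fv) ?sv //.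
by apply: eq_bigr => w _; rewrite /= h_bary // -size_eq0 sv.
Qed.

Lemma sum_prism_map n v (phi : seq Q -> 'F_2) : size v = n ->
  \sum_(w <- prism bQ n (map h v)) phi w =
  \sum_(w <- prism bP n v) phi (map h w).
Proof.
elim: n v phi => [|n IHn] v phi sv; first by rewrite /= !big_nil.
have v0 : v != [::] by rewrite -size_eq0 sv.
rewrite !sum_prismS faces_map big_map /= h_bary //; congr (_ + _).
apply: eq_big_seq => f fv; rewrite (IHn f) ?(size_face fv) ?sv //.
Qed.

End SubdivisionMap.

(** * Affine singular simplices of a standard simplex *)

Section AffineSimplex.
Variables (R : realType) (m n : nat) (u : 'I_m.+1 -> stdsimplex R n).

(** With barycentric coordinates as row vectors, the affine map is
    multiplication by this matrix and composition is associativity. *)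
Definition vertex_matrix : 'M[R]_(m.+1, n.+1) := \matrix_i set_val (u i).

Lemma row_vertex_matrix i : row i vertex_matrix = set_val (u i).
Proof. exact: rowK. Qed.

Lemma affine_simplex_subproof (t : stdsimplex R m) :
  set_val t *m vertex_matrix \in stdsimplex R n.
Proof.
have [t0 t1] : stdsimplex R m (set_val t) by exact: set_valP.
apply/mem_set; split=> [j|].
  rewrite mxE; apply: sumr_ge0 => i _; apply: mulr_ge0; first exact: t0.
  by rewrite mxE; have [+ _] := set_valP (u i); exact.
rewrite -[RHS]t1; under eq_bigr do rewrite mxE.
rewrite exchange_big /=; apply: eq_bigr => i _; rewrite -mulr_sumr.
rewrite -[RHS]mulr1; congr (_ * _); under eq_bigr do rewrite mxE.
by have [_] := set_valP (u i).
Qed.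

Definition affine_simplex_fun (t : stdsimplex R m) : stdsimplex R n :=
  exist _ (set_val t *m vertex_matrix) (affine_simplex_subproof t).

Lemma affine_simplex_fun_continuous : continuous affine_simplex_fun.
Proof.
have cM : continuous (fun t : 'rV[R]_m.+1 => t *m vertex_matrix).
  have -> : (fun t : 'rV[R]_m.+1 => t *m vertex_matrix) =
      (fun t => \sum_i t ord0 i *: row i vertex_matrix).
    by apply/funext => t; rewrite mulmx_sum_row.
  elim: (index_enum _) => [|i r IHr].
    under eq_fun do rewrite big_nil.
    exact: cst_continuous.
  under eq_fun do rewrite big_cons.
  move=> t; have F : Filter (nbhs t) := @nbhs_filter 'rV[R]_m.+1 t.
  have ct := @cvgZr_tmp R 'rV[R]_n.+1 _ (nbhs t) F _ _ (row i vertex_matrix)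
    (@coord_continuous R _ _ ord0 i t).
  exact: (@continuousD R 'rV[R]_n.+1 _ _ _ t ct (IHr t)).
apply/continuousP => U [V oV <-].
exists ((fun t => t *m vertex_matrix) @^-1` V) => //.
by move/continuousP: cM; exact.
Qed.

Definition affine_simplex : continuousType (stdsimplex R m) (stdsimplex R n) :=
  mkcts affine_simplex_fun_continuous.

(** Affine maps are averages, so they do not leave any closed ball which
    contains the vertices. *)
Lemma affine_simplex_ball (y : 'rV[R]_n.+1) r t :
  (forall i, `|set_val (u i) - y| <= r) -> `|set_val (affine_simplex t) - y| <= r.
Proof.
move=> ur; have [t0 t1] : stdsimplex R m (set_val t) by exact: set_valP.
have -> : set_val (affine_simplex t) - y =
    \sum_i set_val t ord0 i *: (set_val (u i) - y).
  under eq_bigr do rewrite scalerBr.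
  rewrite sumrB -scaler_suml t1 scale1r; congr (_ - _).
  transitivity (set_val t *m vertex_matrix) => //.
  by rewrite mulmx_sum_row; apply: eq_bigr => i _; rewrite row_vertex_matrix.
rewrite -[leRHS]mul1r -t1 mulr_suml; apply: le_trans (ler_norm_sum _ _ _) _.
apply: ler_sum => i _; rewrite normrZ ger0_norm ?ler_wpM2l //.
Qed.

End AffineSimplex.

Lemma affine_simplex_comp (R : realType) (k m n : nat)
    (u : 'I_m.+1 -> stdsimplex R n) (w : 'I_k.+1 -> stdsimplex R m) t :
  affine_simplex u (affine_simplex w t) = affine_simplex (affine_simplex u \o w) t.
Proof.
apply: val_inj => /=; rewrite -mulmxA; congr (_ *m _).
by apply/row_matrixP => i; rewrite row_mul !row_vertex_matrix.
Qed.

Lemma affine_simplex_map (R : realType) (k m n : nat)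
    (u : 'I_m.+1 -> stdsimplex R n) (a : 'I_k.+1 -> 'I_m.+1) t :
  affine_simplex u (simplex_map R a t) = affine_simplex (u \o a) t.
Proof.
apply: val_inj => /=; rewrite !mulmx_sum_row.
under eq_bigr do rewrite mxE scaler_suml.
rewrite (exchange_big_dep xpredT) //=; apply: eq_bigr => i _.
rewrite (big_pred1 (a i)) ?row_vertex_matrix // => j; exact: eq_sym.
Qed.

Section Vertices.
Variables (R : realType) (n : nat).
Implicit Types v : seq (stdsimplex R n).

Lemma vertex_subproof i : delta_mx ord0 i \in stdsimplex R n.
Proof.
apply/mem_set; split=> [j|]; first by rewrite mxE; case: (_ && _).
rewrite (bigD1 i) //= mxE !eqxx big1 ?addr0 // => j ji.
by rewrite mxE (negbTE ji) andbF.
Qed.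

Definition vertex i : stdsimplex R n := exist _ (delta_mx ord0 i) (vertex_subproof i).

Lemma affine_simplex_vertex m (u : 'I_n.+1 -> stdsimplex R m) i :
  affine_simplex u (vertex i) = u i.
Proof. by apply: val_inj; rewrite /= -rowE row_vertex_matrix. Qed.

Lemma affine_simplex_id t : affine_simplex vertex t = t.
Proof.
apply: val_inj => /=; rewrite -[RHS]mulmx1; congr (_ *m _).
by apply/row_matrixP => i; rewrite row_vertex_matrix row1.
Qed.

Definition vertices : seq (stdsimplex R n) := [seq vertex i | i <- enum 'I_n.+1].

Lemma size_vertices : size vertices = n.+1.
Proof. by rewrite size_map size_enum_ord. Qed.

Lemma nth_vertices x0 (i : 'I_n.+1) : nth x0 vertices i = vertex i.
Proof. by rewrite (nth_map i) ?size_enum_ord // nth_ord_enum. Qed.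

(** Total on lists; the default value is only reached for the empty one. *)
Definition barycenter (v : seq (stdsimplex R n)) : stdsimplex R n :=
  insubd (vertex ord0) ((size v)%:R^-1 *: \sum_(x <- v) set_val x).

Lemma barycenterE v : v != [::] ->
  set_val (barycenter v) = (size v)%:R^-1 *: \sum_(x <- v) set_val x.
Proof.
rewrite -size_eq0 => v0; rewrite [LHS]insubdK //; apply/mem_set.
split=> [j|]; first rewrite mxE summxE mulr_ge0 ?invr_ge0 ?ler0n //.
  by apply: sumr_ge0 => x _; have [+ _] := set_valP x; exact.
under eq_bigr do rewrite mxE summxE.
rewrite -mulr_sumr exchange_big /= (eq_bigr (fun=> 1)); last first.
  by move=> x _; have [_] := set_valP x.
by rewrite big_const_seq count_predT iter_addr_0 -[X in _ * X]/(_%:R) mulVf // pnatr_eq0.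
Qed.

Lemma barycenter_sub v (y : 'rV[R]_n.+1) : v != [::] ->
  set_val (barycenter v) - y = (size v)%:R^-1 *: \sum_(x <- v) (set_val x - y).
Proof.
move=> v0; rewrite barycenterE // sumrB scalerBr; congr (_ - _).
rewrite big_const_seq count_predT iter_addr_0 -[y *+ _]scaler_nat scalerA mulVf ?scale1r //.
by rewrite pnatr_eq0 size_eq0.
Qed.

Lemma norm_sum_sub_le v (y : 'rV[R]_n.+1) r :
  (forall x, x \in v -> `|set_val x - y| <= r) ->
  `|\sum_(x <- v) (set_val x - y)| <= (size v)%:R * r.
Proof.
move=> vr; apply: le_trans (ler_norm_sum _ _ _) _.
apply: (@le_trans _ _ (\sum_(x <- v) r)).
  by rewrite big_seq [leRHS]big_seq; exact: ler_sum.
by rewrite big_const_seq count_predT iter_addr_0 mulr_natl.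
Qed.

Lemma barycenter_ball v (y : 'rV[R]_n.+1) r : v != [::] ->
  (forall x, x \in v -> `|set_val x - y| <= r) ->
  `|set_val (barycenter v) - y| <= r.
Proof.
move=> v0 vr; have k0 : 0 < (size v)%:R :> R by rewrite ltr0n lt0n size_eq0.
rewrite barycenter_sub // normrZ ger0_norm ?invr_ge0 ?(ltW k0) //.
by rewrite ler_pdivrMl //; exact: norm_sum_sub_le.
Qed.

(** The summand of the barycenter which belongs to [y] itself vanishes; this is
    what brings the ratio below one. *)
Lemma barycenter_dist v N d y : (size v <= N.+1)%N -> y \in v ->
  (forall x, x \in v -> `|set_val x - set_val y| <= d) ->
  `|set_val (barycenter v) - set_val y| <= (1 - N.+1%:R^-1) * d.
Proof.
move=> vN yv vd; have v0 : v != [::] by case: v yv {vN vd}.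
have k0 : 0 < (size v)%:R :> R by rewrite ltr0n lt0n size_eq0.
have d0 : 0 <= d by apply: le_trans (vd _ yv).
rewrite barycenter_sub // normrZ ger0_norm ?invr_ge0 ?(ltW k0) //.
rewrite (perm_big _ (perm_to_rem yv)) big_cons subrr /= add0r.
apply: (@le_trans _ _ ((size v)%:R^-1 * ((size v).-1%:R * d))).
  rewrite ler_wpM2l ?invr_ge0 ?(ltW k0) // -(size_rem yv).
  by apply: norm_sum_sub_le => x /mem_rem; exact: vd.
rewrite mulrA ler_wpM2r // -subn1 natrB; last by rewrite -(ltr0n R).
rewrite mulrBr mulVf ?gt_eqF // mulr1 lerB // lef_pV2 ?posrE ?ltr0n ?ler_nat //.
by rewrite -(ltr0n R).
Qed.

End Vertices.

Lemma barycenter_map (R : realType) (m n : nat) (u : 'I_m.+1 -> stdsimplex R n) v :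
  v != [::] ->
  barycenter (map (affine_simplex u) v) = affine_simplex u (barycenter v).
Proof.
move=> v0; apply: val_inj; rewrite -!set_valE barycenterE; last by case: v v0.
rewrite size_map big_map.
transitivity (set_val (barycenter v) *m vertex_matrix u) => //.
by rewrite barycenterE // -scalemxAl mulmx_suml.
Qed.

(** * Subdivision makes simplices small *)

Section Mesh.
Variables (R : realType) (n : nat).
Implicit Types v w : seq (stdsimplex R n).

Definition diameter_le v (d : R) :=
  forall x y, x \in v -> y \in v -> `|set_val x - set_val y| <= d.

Lemma subdivision_ball k v w (y : 'rV[R]_n.+1) r : size v = k ->
  (forall x, x \in v -> `|set_val x - y| <= r) ->
  w \in subdivision (@barycenter R n) k v ->
  forall x, x \in w -> `|set_val x - y| <= r.
Proof.
move=> sv vr; apply: (subdivision_ind sv _ vr) => u u0 ur.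
exact: barycenter_ball.
Qed.

(** A new simplex consists of the barycenter and of a simplex in the subdivision
    of a face.  Distances from the barycenter contract by [barycenter_dist] at
    the vertices of the face, hence by convexity everywhere in it.  A ratio
    which depends only on the bound [N] survives the induction on [k]. *)
Lemma subdivision_diameter k N v w d : size v = k -> (k <= N.+1)%N ->
  diameter_le v d -> w \in subdivision (@barycenter R n) k v ->
  diameter_le w ((1 - N.+1%:R^-1) * d).
Proof.
elim: k v w => [|k IHk] v w sv kN vd /=; first by rewrite inE => /eqP ->.
case/allpairsPdep => f [g [fv gf ->]].
have sf : size f = k by rewrite (size_face fv) sv.
have vf := mem_face fv.
have bg x : x \in g ->
    `|set_val x - set_val (barycenter v)| <= (1 - N.+1%:R^-1) * d.
  apply: (subdivision_ball sf _ gf) => z /vf zv.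
  rewrite distrC; apply: barycenter_dist => //; first by rewrite sv.
  by move=> y yv; exact: vd.
have d0 : 0 <= d.
  case: v sv vd {fv vf bg} => // x v _ vd.
  by apply: le_trans (vd x x _ _); rewrite ?inE ?eqxx.
move=> x y; rewrite !inE => /predU1P[->|xg] /predU1P[->|yg].
- rewrite subrr normr0 mulr_ge0 // subr_ge0 invf_le1 ?ltr0n // ler1n //.
- by rewrite distrC; exact: bg.
- exact: bg.
- apply: (IHk f g) => //; first exact: ltnW.
  by move=> a b /vf av /vf bv; exact: vd.
Qed.

End Mesh.

(** A radius which works near [x] is found by halving one which works at [x];
    compactness makes one radius work for all points. *)
Lemma lebesgue_number (R : realType) (M : pseudoMetricType R) (K : set M)
    (I : Type) (V : I -> set M) :
  compact K -> (forall i, open (V i)) -> K `<=` \bigcup_i V i ->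
  exists2 e : R, 0 < e & forall x, K x -> exists i, ball x e `<=` V i.
Proof.
move=> /compact_near_coveringP cK oV KV.
pose P (e : R) (x : M) := exists i, ball x e `<=` V i.
have : \forall e \near 0^'+, K `<=` P e.
  apply: cK => x /KV[i _ Vix].
  have /nbhs_ballP[e /= e0 xe] := open_nbhs_nbhs (conj (oV i) Vix).
  exists (ball x (e / 2), [set d | d < e / 2]) => /=.
    split; first by apply: nbhsx_ballx; exact: divr_gt0.
    by apply: nbhs_right_lt; exact: divr_gt0.
  move=> [y d] /= [xy de]; exists i => z yz; apply: xe.
  rewrite (splitr e); apply: ball_triangle xy _.
  by apply: le_ball yz; exact: ltW.
move=> KP; have [e [e0 Ke]] : exists e : R, 0 < e /\ K `<=` P e.
  near ((0:R)^'+) => e; exists e; split.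
    by near: e; exact: nbhs_right_gt.
  by near: e.
by exists e => // x /Ke.
Unshelve. all: by end_near. Qed.

Lemma stdsimplex_norm (R : realType) (n : nat) t : stdsimplex R n t -> `|t| <= 1.
Proof.
move=> [t0 t1]; rewrite /= /Num.norm /= mx_normrE.
apply: bigmax_le => // -[i j] _ /=.
by rewrite ord1 ger0_norm // -t1 (bigD1 j) //= lerDl sumr_ge0.
Qed.

Lemma stdsimplex_compact (R : realType) (n : nat) : compact (stdsimplex R n).
Proof.
apply: bounded_closed_compact.
  exists 1; split=> // r r1 t /stdsimplex_norm tn.
  exact: le_trans (ltW r1).
have -> : stdsimplex R n = \bigcap_i [set t | 0 <= t ord0 i] `&`
    [set t | \sum_i t ord0 i = 1].
  apply/seteqP; split=> t [t0 t1]; split=> // i; first by move=> _; exact: t0.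
  exact: t0.
apply: closedI.
  apply: closed_bigI => i _.
  have /continuous_closedP : continuous (fun t : 'rV[R]_n.+1 => t ord0 i).
    exact: coord_continuous.
  by move=> /(_ _ (@closed_ge R 0)).
have /continuous_closedP := @coord_sum_continuous R n (index_enum _) xpredT.
by move=> /(_ _ (@closed_eq R 1)).
Qed.

(** * Subdivision of singular cochains *)

Section CochainSubdivision.
Variables (R : realType) (X : topologicalType).

(** Meant for lists [v] of length [m.+1]; leaving [m] free avoids casts along
    equations between sizes. *)
Definition along {m n} (s : singular R n X) (v : seq (stdsimplex R n)) :
    singular R m X :=
  [the continuousType _ _ of s \o
    affine_simplex (fun i : 'I_m.+1 => nth (vertex R ord0) v i)].

Lemma along_vertices n (s : singular R n X) : along s (vertices R n) = s.
Proof.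
apply/continuousEP => t /=; rewrite (_ : (fun i => _) = @vertex R n).
  by rewrite affine_simplex_id.
by apply/funext => i; exact: nth_vertices.
Qed.

Lemma map_affine_vertices m n (v : seq (stdsimplex R n)) : size v = m.+1 ->
  [seq affine_simplex (fun i : 'I_m.+1 => nth (vertex R ord0) v i) x
     | x <- vertices R m] = v.
Proof.
move=> sv; apply: (@eq_from_nth _ (vertex R ord0)).
  by rewrite size_map size_vertices.
move=> i; rewrite size_map size_vertices => im.
rewrite (nth_map (vertex R ord0)) ?size_vertices //.
by rewrite (nth_vertices _ (Ordinal im)) affine_simplex_vertex.
Qed.

Lemma along_along k m n (s : singular R n X) v (w : seq (stdsimplex R m)) :
  size w = k.+1 ->
  along (along s v : singular R m X) w =
  along s [seq affine_simplex (fun i : 'I_m.+1 => nth (vertex R ord0) v i) x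
    | x <- w] :> singular R k X.
Proof.
move=> sw; apply/continuousEP => t /=; rewrite affine_simplex_comp.
congr (s (affine_simplex _ t)); apply/funext => i /=.
by rewrite (nth_map (vertex R ord0)) // sw.
Qed.

Lemma delta_along m n (s : singular R n X) v (c : cochain R m X) :
  size v = m.+2 -> delta c (along s v) = \sum_(f <- faces v) c (along s f).
Proof.
move=> sv; rewrite (big_nth [::]) size_faces sv big_mkord.
apply: eq_bigr => i _; congr c; apply/continuousEP => t /=.
rewrite affine_simplex_map; congr (s (affine_simplex _ t)).
by apply/funext => k /=; rewrite nth_face ?sv.
Qed.

Definition cochain_subdivision n (c : cochain R n X) : cochain R n X :=
  fun s => \sum_(w <- subdivision (@barycenter R n) n.+1 (vertices R n))
    c (along s w).

Definition cochain_prism n (c : cochain R n.+1 X) : cochain R n X :=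
  fun s => \sum_(w <- prism (@barycenter R n) n.+1 (vertices R n)) c (along s w).

(** Naturality: affine maps preserve barycenters, so the subdivision of an affine
    simplex is the image of the subdivided standard simplex. *)
Lemma cochain_subdivision_along m n (c : cochain R m X) (s : singular R n X) v :
  size v = m.+1 ->
  cochain_subdivision c (along s v) =
  \sum_(w <- subdivision (@barycenter R n) m.+1 v) c (along s w).
Proof.
move=> sv; rewrite -[in RHS](map_affine_vertices sv).
rewrite (sum_subdivision_map (@barycenter_map _ _ _ _)) ?size_vertices //.
apply: eq_big_seq => w /(size_subdivision (size_vertices R m)) sw.
by rewrite along_along.
Qed.

Lemma cochain_prism_along m n (c : cochain R m.+1 X) (s : singular R n X) v :
  size v = m.+1 ->
  cochain_prism c (along s v) =
  \sum_(w <- prism (@barycenter R n) m.+1 v) c (along s w).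
Proof.
move=> sv; rewrite -[in RHS](map_affine_vertices sv).
rewrite (sum_prism_map (@barycenter_map _ _ _ _)) ?size_vertices //.
apply: eq_big_seq => w /(size_prism (size_vertices R m)) sw.
by rewrite along_along.
Qed.

Lemma delta_subdivision n (c : cochain R n X) :
  delta (cochain_subdivision c) = cochain_subdivision (delta c).
Proof.
apply/funext => s; rewrite -[in LHS](along_vertices s) delta_along ?size_vertices //.
under [RHS]eq_big_seq => w /(size_subdivision (size_vertices R _)) sw
  do rewrite delta_along //.
rewrite (subdivision_boundary _ (fun f => c (along s f))) ?size_vertices //.
apply: eq_big_seq => f fv; rewrite cochain_subdivision_along //.
by rewrite (size_face fv) size_vertices.
Qed.

Lemma cochain_prism_homotopy n (c : cochain R n.+1 X) :
  cochain_prism (delta c) + delta (cochain_prism c) = c + cochain_subdivision c.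
Proof.
apply/funext => s.
transitivity (cochain_prism (delta c) s + delta (cochain_prism c) s) => //.
transitivity (c s + cochain_subdivision c s) => //.
rewrite -[in X in _ + X = _](along_vertices s) delta_along ?size_vertices //.
rewrite -[in X in _ = X + _](along_vertices s).
rewrite -(prism_boundary _ (fun f => c (along s f)) (size_vertices R _)).
congr (_ + _).
  apply: eq_big_seq => w /(size_prism (size_vertices R _)) sw.
  by rewrite delta_along.
apply: eq_big_seq => f fv; rewrite cochain_prism_along //.
by rewrite (size_face fv) size_vertices.
Qed.

(** In degree zero the boundary term only involves the prism on the empty list,
    which is zero. *)
Lemma cochain_prism_homotopy0 (c : cochain R 0 X) :
  cochain_prism (delta c) = c + cochain_subdivision c.
Proof.
apply/funext => s; transitivity (c s + cochain_subdivision c s) => //.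
rewrite -[in X in _ = X + _](along_vertices s).
rewrite -(prism_boundary _ (fun f => c (along s f)) (size_vertices R _)).
rewrite [X in _ + X](_ : _ = 0); last by rewrite big1 // => f _; rewrite big_nil.
rewrite addr0; apply: eq_big_seq => w /(size_prism (size_vertices R _)) sw.
by rewrite delta_along.
Qed.

Lemma cochain_subdivisionD n (b c : cochain R n X) :
  cochain_subdivision (b + c) = cochain_subdivision b + cochain_subdivision c.
Proof. by apply/funext => s; exact: big_split. Qed.

Lemma cochain_prism0 n : cochain_prism (0 : cochain R n.+1 X) = 0.
Proof. by apply/funext => s; exact: big1. Qed.

End CochainSubdivision.

(** * Cocycles vanishing on small simplices *)

Section SmallSimplices.
Variables (R : realType) (X : topologicalType).

Definition in_set n (U : set X) (s : singular R n X) := forall t, U (s t).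

Definition vanishes_on n (U : set X) (c : cochain R n X) :=
  forall s, in_set U s -> c s = 0.

Lemma in_set_along m n U (s : singular R n X) v :
  in_set U s -> in_set U (along s v : singular R m X).
Proof. by move=> Us t; exact: Us. Qed.

Variables (I : Type) (A : I -> set X).
Hypotheses (A_open : forall i, open (A i)) (A_cover : \bigcup_i A i = setT).

(** The preimages of the [A i] under [s] form an open cover of a compact simplex,
    and an affine simplex stays in the ball around its first vertex whose radius
    is the diameter. *)
Lemma lebesgue_singular n (s : singular R n X) :
  exists2 e : R, 0 < e & forall m (v : seq (stdsimplex R n)) d,
    size v = m.+1 -> diameter_le v d -> d < e ->
    exists i, in_set (A i) (along s v : singular R m X).
Proof.
have /choice[V HV] i : exists V : set 'rV[R]_n.+1,
    open V /\ set_val @^-1` V = s @^-1` (A i).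
  have /continuousP/(_ _ (A_open i)) [V oV sV] := @cts_fun _ _ s.
  by exists V.
have VA i (x : stdsimplex R n) : V i (set_val x) -> A i (s x).
  move=> Vx; have : (set_val @^-1` V i) x by [].
  by rewrite (HV i).2.
have cov : stdsimplex R n `<=` \bigcup_i V i.
  move=> x /mem_set xD; pose y : stdsimplex R n := exist _ x xD.
  have : [set: X] (s y) by []; rewrite -A_cover => -[i _ Ay].
  exists i => //; have : (s @^-1` A i) y by [].
  by rewrite -(HV i).2.
have [e e0 He] :=
  lebesgue_number (@stdsimplex_compact R n) (fun i => (HV i).1) cov.
exists e => // m v d sv vd de; set x := nth (vertex R ord0) v 0.
have [i xi] := He _ (set_valP x); exists i => t; apply/VA/xi.
rewrite -ball_normE /= distrC; apply: le_lt_trans de.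
by apply: affine_simplex_ball => k; apply: vd; apply: mem_nth; rewrite sv.
Qed.

(** The diameters shrink geometrically, so that after finitely many steps they are
    below the Lebesgue number of [s]. *)
Lemma iter_subdivision_small n (s : singular R n X) :
  exists M, forall m (c : cochain R n X), (M <= m)%N ->
    (forall i, vanishes_on (A i) c) -> iter m (@cochain_subdivision R X n) c s = 0.
Proof.
have [e e0 He] := lebesgue_singular s.
pose k : R := 1 - n.+1%:R^-1.
have k0 : 0 <= k by rewrite subr_ge0 invf_le1 ?ltr0n // ler1n.
have k1 : k < 1 by rewrite ltrBlDr ltrDl invr_gt0 ltr0n.
have [M HM] : exists M, forall m, (M <= m)%N -> k ^+ m * 2 < e.
  have /cvgrPdist_lt /(_ (e / 2)) : (fun m => k ^+ m) @ \oo --> (0 : R).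
    by apply: cvg_expr; rewrite ger0_norm.
  case; first exact: divr_gt0.
  move=> M _ HM; exists M => m /HM /=.
  by rewrite sub0r normrN ger0_norm ?exprn_ge0 // ltr_pdivlMr.
exists M => m c /HM me Ac.
have claim v d : size v = n.+1 -> diameter_le v d -> k ^+ m * d < e ->
    iter m (@cochain_subdivision R X n) c (along s v) = 0.
  elim: m {me} v d => [|m IHm] v d sv vd; rewrite ?expr0 ?mul1r => de.
    by have [i /Ac] := He _ _ _ sv vd de.
  rewrite iterS cochain_subdivision_along // big_seq big1 // => w wv.
  apply: (IHm _ (k * d)); first exact: size_subdivision wv.
    by apply: subdivision_diameter wv.
  by rewrite mulrA -exprSr.
rewrite -(along_vertices s); apply: claim me; first exact: size_vertices.
(* Both points have norm at most 1, which explains the initial diameter 2. *)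
move=> x y _ _; apply: le_trans (ler_normB _ _) _.
by apply: lerD; apply: stdsimplex_norm; exact: set_valP.
Qed.

(** In positive degree the primitive of [c] is the sum of all [S^m T c]; on the
    simplex [s] the terms with [bd s <= m] are zero.  In degree zero a cocycle is
    invariant under subdivision, hence zero. *)
Theorem small_cocycle_coboundary n (c : cochain R n X) :
  delta c = 0 -> (forall i, vanishes_on (A i) c) -> coboundary c.
Proof.
pose S k := @cochain_subdivision R X k.
have itD k m (a b : cochain R k X) : iter m (S k) (a + b) = iter m (S k) a + iter m (S k) b.
  by elim: m => //= m ->; exact: cochain_subdivisionD.
have itd k m (a : cochain R k X) : delta (iter m (S k) a) = iter m (S k.+1) (delta a).
  by elim: m => //= m <-; exact: delta_subdivision.
have addcc k (a : cochain R k X) : a + a = 0.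
  by apply/funext => s; exact: F2_addrr.
case: n c => [|n] c c0 Ac /=.
  have Sc : S 0%N c = c.
    have := cochain_prism_homotopy0 c; rewrite c0 cochain_prism0 => /esym.
    by move/(congr1 (+%R c)); rewrite addr0 addrA addcc add0r.
  apply/funext => s; have [M HM] := iter_subdivision_small s.
  have SM m : iter m (S 0%N) c = c by elim: m => //= m ->.
  by rewrite -(SM M); exact: HM.
have /choice[bd Hbd] := @iter_subdivision_small n.
pose e m := iter m (S n) (cochain_prism c).
have e0 m s : (bd s <= m)%N -> e m s = 0.
  move=> sm; apply: Hbd => // i u Au; apply: big1 => w _.
  by apply: Ac; exact: in_set_along.
have de m : delta (e m) = iter m (S n.+1) c + iter m.+1 (S n.+1) c.
  rewrite itd iterSr -itD; congr iter.
  by have := cochain_prism_homotopy c; rewrite c0 cochain_prism0 add0r.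
exists (fun s => \sum_(m < bd s) e m s).
(* [N] is large enough for [s] and for all its faces. *)
apply/funext => s; have [M HM] := iter_subdivision_small s.
pose N := maxn M (\max_(i < n.+2) bd (Defs.reindex s (lift i))).
have iN : iter N (S n.+1) c s = 0 by apply: HM => //; exact: leq_maxl.
have ext u : (bd u <= N)%N -> \sum_(m < bd u) e m u = \sum_(m < N) e m u.
  move=> uN; rewrite -!(big_mkord xpredT (fun m => e m u)).
  rewrite (big_cat_nat (leq0n _) uN) //= [X in _ + X]big_nat_cond.
  by rewrite [X in _ + X]big1 ?addr0 // => m /andP[/andP[um _] _]; exact: e0.
transitivity (\sum_(i < n.+2) \sum_(m < N) e m (Defs.reindex s (lift i))).
  apply: eq_bigr => i _; apply: ext; apply: leq_trans (leq_maxr _ _).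
  exact: (leq_bigmax i).
rewrite exchange_big /=.
transitivity (\sum_(m < N) (iter m (S n.+1) c s + iter m.+1 (S n.+1) c s)).
  by apply: eq_bigr => m _; rewrite -[RHS]/((_ + _) s) -de.
transitivity (c s + iter N (S n.+1) c s); last by rewrite iN addr0.
elim: (N) => [|m IHm]; first by rewrite big_ord0 F2_addrr.
by rewrite big_ord_recr /= IHm -addrA; congr (_ + _); rewrite addrA F2_addrr add0r.
Qed.

End SmallSimplices.

(** * Classes vanishing on an open set *)

Lemma cohomology_class_eq0 (R : realType) (X : topologicalType) n (z : cocycle R n X) :
  cohomology_class z = 0 <-> coboundary (cocycle_val z).
Proof.
have -> : 0 = cohomology_class (0 : cocycle R n X) by rewrite /cohomology_class raddf0.
have := cohomology_classP z 0.
by rewrite (_ : cocycle_val 0 = 0) ?subr0.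
Qed.

Section RelativeClasses.
Variables (R : realType) (X : topologicalType).

Lemma delta_delta n (c : cochain R n X) : delta (delta c) = 0.
Proof.
apply/funext => s; rewrite -[in LHS](along_vertices s) delta_along ?size_vertices //.
rewrite -[RHS](sum_faces_faces (vertices R n.+2) (fun g => c (along s g))).
apply: eq_big_seq => f fv; apply: delta_along.
by rewrite (size_face fv) size_vertices.
Qed.

Section Inclusion.
Variable A : set X.

Definition inclusion : continuousType A X :=
  mkcts (@initial_continuous A X set_val).

Lemma push_inclusion_inj n : injective (@push R n _ _ inclusion).
Proof.
move=> s t /continuousEP st; apply/continuousEP => x.
by apply: val_inj; exact: st.
Qed.

Lemma push_inclusion_in_set n (s : singular R n X) : in_set A s ->
  exists t, push inclusion t = s.
Proof.
move=> As; pose f x : A := exist _ (s x) (mem_set (As x)).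
have cf : continuous f.
  apply/continuousP => U [V oV <-].
  by have /continuousP/(_ _ oV) := @cts_fun _ _ s.
by exists (mkcts cf); apply/continuousEP.
Qed.

Lemma cochain_extend n (b : cochain R n A) :
  exists c : cochain R n X, cochain_pull inclusion c = b.
Proof.
exists (fun s => if pselect (exists t, push inclusion t = s) is left H
                 then b (projT1 (cid H)) else 0).
apply/funext => t; rewrite /cochain_pull /=.
case: pselect => [H|[]]; last by exists t.
by case: cid => u /= /push_inclusion_inj ->.
Qed.

Lemma vanishes_on_pull n (c : cochain R n X) :
  cochain_pull inclusion c = 0 -> vanishes_on A c.
Proof.
by move=> c0 s /push_inclusion_in_set[t <-]; exact: (congr1 (@^~ t) c0).
Qed.

(** A cochain on [A] whose coboundary is the restriction of the cocycle can be
    extended by zero to the simplices which are not contained in [A], and the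
    cocycle corrected by the coboundary of this extension. *)
Lemma relative_representative n (xi : cohomology R n X) :
  cohomology_pull inclusion xi = 0 ->
  exists z : cocycle R n X, cohomology_class z = xi /\ vanishes_on A z.
Proof.
move=> xi0; set z := repr xi.
have : coboundary (cocycle_val (cocycle_pull inclusion z)).
  by apply/cohomology_class_eq0.
case: n xi xi0 @z => [|n] xi xi0 z /=.
  move=> z0; exists z; split; first exact: cohomology_reprK.
  exact: vanishes_on_pull.
move=> [b bz]; have [c cb] := cochain_extend b.
have y0 : cocycle_val z - delta c \in @cocycles R n.+1 X.
  by apply/eqP; rewrite deltaB cocycleP delta_delta subrr.
exists (Cocycle y0); split.
  rewrite -[RHS]cohomology_reprK; apply/cohomology_classP.
  exists (- c); rewrite -[- c]sub0r deltaB delta0 sub0r.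
  by rewrite -[RHS]/(cocycle_val z - delta c - cocycle_val z) addrAC subrr add0r.
apply: vanishes_on_pull; apply/funext => s.
transitivity (cochain_pull inclusion z s - cochain_pull inclusion (delta c) s) => //.
by rewrite -delta_pull cb bz subrr.
Qed.

End Inclusion.

Lemma in_set_reindex m n U (s : singular R n X) (a : 'I_m.+1 -> 'I_n.+1) :
  in_set U s -> in_set U (Defs.reindex s a).
Proof. by move=> Us t; exact: Us. Qed.

(** The front and back faces of a simplex contained in [A i] are contained in
    [A i], so one vanishing factor is enough for the product to vanish there. *)
Lemma cup_prod_representative l (d : 'I_l -> nat)
    (xi : forall i, cohomology R (d i) X) (A : 'I_l -> set X) :
  (forall i, cohomology_pull (inclusion (A i)) (xi i) = 0) ->
  exists z : cocycle R (tag (cup_prod xi)) X,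
    cohomology_class z = tagged (cup_prod xi) /\ forall i, vanishes_on (A i) z.
Proof.
move=> xi0; suff : exists z : cocycle R (tag (cup_prod xi)) X,
    cohomology_class z = tagged (cup_prod xi) /\
    {in index_enum 'I_l, forall i, vanishes_on (A i) z}.
  by move=> [z [zxi Az]]; exists z; split=> // i; apply: Az; exact: mem_index_enum.
rewrite /cup_prod; elim: (index_enum _) => [|i r [z [zr Az]]].
  by rewrite big_nil; exists (Cocycle (cocycle_one_subproof R X)).
rewrite big_cons; have [y [yxi Ay]] := relative_representative (xi0 i).
exists (cocycle_cup y z); split; first by rewrite -cup_class yxi zr.
move=> j; rewrite inE => /predU1P[->|jr] s As; rewrite /= /cochain_cup.
  by rewrite Ay ?mul0r //; exact: in_set_reindex.
by rewrite (Az j jr) ?mulr0 //; exact: in_set_reindex.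
Qed.

(** The vanishing lemma of Lusternik and Schnirelmann: a representative of the
    product vanishes on all simplices subordinate to the cover. *)
Lemma cup_prod_eq0 l (d : 'I_l -> nat) (xi : forall i, cohomology R (d i) X)
    (A : 'I_l -> set X) :
  (forall i, open (A i)) -> \bigcup_i A i = setT ->
  (forall i, cohomology_pull (inclusion (A i)) (xi i) = 0) ->
  tagged (cup_prod xi) = 0.
Proof.
move=> oA cA /cup_prod_representative[z [<- Az]]; apply/cohomology_class_eq0.
exact: (small_cocycle_coboundary oA cA (cocycleP z)).
Qed.

End RelativeClasses.

(** * The genus of a pull-back *)

Section Genus.
Variables (E B : topologicalType) (p : continuousType E B).

Lemma continuous_corestrict (X Y : topologicalType) (A : set Y) (f : X -> A) :
  continuous (fun x => set_val (f x)) -> continuous f.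
Proof.
move=> cf; apply/continuousP => U [V oV <-].
by move/continuousP: cf => /(_ _ oV).
Qed.

Lemma has_section_over_set0 : has_section_over p set0.
Proof.
pose s (x : (set0 : set B)) : E := False_rect E (set_valP x).
have cs : continuous s by move=> x; case: (set_valP x).
by exists (mkcts cs) => x; case: (set_valP x).
Qed.

Lemma has_section_over_pullback (X : topologicalType) (f : continuousType X B) U :
  has_section_over p U -> has_section_over (pullback_map p f) (f @^-1` U).
Proof.
move=> [s ps].
pose y (x : (f @^-1` U : set X)) : U := exist _ (f (set_val x)) (mem_set (set_valP x)).
have cy : continuous y.
  apply: continuous_corestrict => x; apply: continuous_comp.
    exact: initial_continuous.
  exact: cts_fun.
pose t x : pullback_space p f :=
  exist _ (set_val x, s (y x)) (mem_set (esym (ps (y x)))).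
have ct : continuous t.
  apply: continuous_corestrict => x; apply: cvg_pair.
  - exact: (@nbhs_filter (f @^-1` U : set X) x).
  - exact: (@initial_continuous _ X set_val x).
  - by apply: (continuous_comp (@cy x)); exact: cts_fun.
by exists (mkcts ct).
Qed.

Lemma genus_pullback (R : realType) (X : topologicalType) (f : continuousType X B)
    k (U : 'I_k -> set B) :
  (forall i, open (U i) /\ has_section_over p (U i)) ->
  (forall x, exists i, U i (f x)) ->
  (genus R (pullback_map p f) <= k%:R%:E)%E.
Proof.
move=> Us fU; apply: ereal_inf_lbound; exists k => //.
exists (fun i => f @^-1` U i); split=> [i|].
  split; last by apply: has_section_over_pullback; exact: (Us i).2.
  by have /continuousP := @cts_fun _ _ f; apply; exact: (Us i).1.
by apply/seteqP; split=> // x _; have [i] := fU x; exists i.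
Qed.

Lemma genus_attained (R : realType) : (genus R p < +oo)%E ->
  exists (k : nat) (U : 'I_k -> set B),
    sectional_cover p U /\ genus R p = k%:R%:E.
Proof.
pose P (k : nat) := `[< exists U : 'I_k -> set B, sectional_cover p U >].
move=> gfin; have exP : exists k, P k.
  apply: contrapT => /forallNP nP; move: gfin; rewrite /genus.
  have -> : [set k : nat | exists U : 'I_k -> set B, sectional_cover p U] = set0.
    by rewrite -subset0 => k kP; apply: (nP k); exact/asboolP.
  by rewrite image_set0 ereal_inf0 ltxx.
exists (ex_minn exP); case: ex_minnP => k /asboolP[U UP] kmin; exists U; split=> //.
apply/eqP; rewrite eq_le; apply/andP; split.
  by apply: ereal_inf_lbound; exists k => //; exists U.
apply: le_ereal_inf_tmp => _ [j jP <-]; rewrite lee_fin ler_nat.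
by apply: kmin; exact/asboolP.
Qed.

(** A supremum of natural numbers is either attained or infinite, in which case
    some member reaches the given [k]. *)
Lemma ereal_sup_nat (R : realType) (S : set nat) (k : nat) : S 0%N ->
  exists j, S j /\ ((k <= j)%N \/ ereal_sup [set (i%:R : R)%:E | i in S] = j%:R%:E).
Proof.
move=> S0; have [[j Sj kj]|nS] := pselect (exists2 j, S j & (k <= j)%N).
  by exists j; split=> //; left.
have Sk i : S i -> (i <= k)%N.
  by move=> Si; rewrite leqNgt; apply/negP => ki; apply: nS; exists i => //; exact: ltnW.
have exS : exists i, `[< S i >] by exists 0%N; exact/asboolP.
have Sk' i : `[< S i >] -> (i <= k)%N by move=> /asboolP /Sk.
case: (ex_maxnP exS Sk') => j /asboolP Sj jmax; exists j; split=> //; right.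
apply/eqP; rewrite eq_le; apply/andP; split.
  by apply: ge_ereal_sup => _ [i Si <-]; rewrite lee_fin ler_nat; apply/jmax/asboolP.
by apply: ereal_sup_ubound; exists j.
Qed.

(** Number the pairs [(i, a)] with [a < m i]; there are at least [k] of them.  Pair
    number [j] receives [U j] if [j < k] and the empty set otherwise. *)
Lemma distribute l k (m : 'I_l -> nat) (U : 'I_k -> set B) :
  (k <= \sum_i m i)%N ->
  (forall i, open (U i) /\ has_section_over p (U i)) ->
  exists V : forall i, 'I_(m i) -> set B,
    (forall i a, open (V i a) /\ has_section_over p (V i a)) /\
    forall j, exists i a, V i a = U j.
Proof.
move=> km Us; pose T := {i : 'I_l & 'I_(m i)}.
have kT : (k <= #|{: T}|)%N.
  rewrite card_tagged sumnE big_map big_enum /=.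
  by under eq_bigr do rewrite card_ord.
pose V i (a : 'I_(m i)) :=
  if insub (enum_rank (Tagged (fun i => 'I_(m i)) a) : nat) is Some j then U j else set0.
exists V; split=> [i a|j]; rewrite /V.
  case: insub => [j|]; first exact: Us.
  by split; [exact: open0 | exact: has_section_over_set0].
pose t : T := enum_val (widen_ord kT j).
exists (tag t), (tagged t); rewrite /V.
have -> : Tagged (fun i => 'I_(m i)) (tagged t) = t by case: (t).
by rewrite enum_valK /= valK.
Qed.

End Genus.

(** * The cohomological lower bound for the genus *)

Lemma cohomology_empty (R : realType) (X : topologicalType) n (xi : cohomology R n X) :
  (X -> False) -> xi = 0.
Proof.
move=> X0; rewrite -(cohomology_reprK xi); apply/cohomology_class_eq0.
rewrite (_ : cocycle_val _ = 0); first exact: coboundary0.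
by apply/funext => s; case: (X0 (s (vertex R ord0))).
Qed.

Local Open Scope ereal_scope.

Theorem theorem33 (R : realType) (E B : topologicalType)
    (p : continuousType E B) (l : nat) (d : 'I_l -> nat)
    (xi : forall i : 'I_l, cohomology R (d i) B) :
  fibration R p ->
  (forall i : 'I_l, (0 < d i)%N) ->
  tagged (cup_prod xi) != 0%R ->
  (* excludes only the meaningless comparison of +oo with itself *)
  genus R p < +oo \/ \sum_(i < l) wgt p (xi i) < +oo ->
  \sum_(i < l) wgt p (xi i) < genus R p.
Proof.
move=> _ _ xi_neq0 fin; rewrite ltNge; apply/negP => wgt_ge.
have gfin : genus R p < +oo by case: fin => // /(le_lt_trans wgt_ge).
have [k [U [[Us cU] gk]]] := genus_attained gfin.
(* [0] is admissible, because genus 0 forces an empty source; so the set of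
   admissible integers has a maximum, the weight, or it contains one of at least [k]. *)
have /choice[m Hm] i : exists m, (forall (X : topologicalType) (f : continuousType X B),
    genus R (pullback_map p f) <= m%:R%:E -> cohomology_pull f (xi i) = 0%R) /\
    ((k <= m)%N \/ wgt p (xi i) = m%:R%:E).
  apply: ereal_sup_nat => X f g0; apply: cohomology_empty => x.
  have [j [V [[_ cV] gj]]] := genus_attained (le_lt_trans g0 (ltry _)).
  have : [set: X] x by []; rewrite -cV => -[a _ _].
  move: g0; rewrite gj lee_fin ler_nat => j0.
  by have := leq_trans (ltn_ord a) j0.
have km : (k <= \sum_i m i)%N.
  have [[i ki]|nk] := pselect (exists i, (k <= m i)%N).
    by apply: leq_trans ki _; rewrite (bigD1 i) //= leq_addr.
  rewrite -(ler_nat R) natr_sum -lee_fin -gk -sumEFin; apply: le_trans wgt_ge _.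
  rewrite le_eqVlt; apply/orP; left; apply/eqP; apply: eq_bigr => i _.
  by have [_ [ki|//]] := Hm i; case: nk; exists i.
have [V [Vs VU]] := distribute km Us.
pose A i := \bigcup_a V i a.
move/eqP: xi_neq0; apply; apply: (@cup_prod_eq0 _ _ _ _ _ A).
- by move=> i; apply: bigcup_open => a _; exact: (Vs i a).1.
- apply/seteqP; split=> // x; rewrite -cU => -[j _].
  by have [i [a <-]] := VU j => Vx; exists i => //; exists a.
- move=> i; apply: (Hm i).1; apply: (genus_pullback _ (Vs i)).
  by move=> x; have [a _ Va] := set_valP x; exists a.
Qed.
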